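(* Let $\Gamma$ be a non-empty set, let $B$ be the closed unit ball of the real Banach space $\ell_\infty(\Gamma)$, and let $F\colon B\to B$ be a non-expansive bijection. Then $F(\operatorname{ext} B)\subset \operatorname{ext} B$.
   Context: $\ell_\infty(\Gamma)$ is the real Banach space of all bounded functions $x\colon\Gamma\to\mathbb R$ with the norm $\|x\|_\infty=\sup_{\gamma\in\Gamma}|x_\gamma|$. A mapping $F\colon B\to B$ is called non-expansive if it is $1$-Lipschitz, i.e. $\|F(x)-F(y)\|_\infty\le\|x-y\|_\infty$ for all $x,y\in B$. $\operatorname{ext} B$ denotes the set of extreme points of the convex set $B$. *)

(* Defs.v *)
From HB Require Import structures.
From mathcomp Require Import all_boot all_order all_algebra.
From mathcomp Require Import all_classical all_reals all_analysis.

Set Implicit Arguments.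
Unset Strict Implicit.
Unset Printing Implicit Defensive.

Import Order.TTheory GRing.Theory Num.Theory.
Import numFieldNormedType.Exports.

Local Open Scope classical_set_scope.
Local Open Scope ring_scope.

Section Linfty.
Variables (Gamma : Type) (R : realType).

Definition linfty_pred : {pred Gamma -> R} :=
  mem (bounded_fun : set (Gamma -> R^o)).

Lemma linfty_predP (f : Gamma -> R) :
  reflect (exists M, forall g, `|f g| <= M) (f \in linfty_pred).
Proof.
apply: (iffP idP) => [|[M fM]]; rewrite inE /=.
  move=> [M [_ fM]]; exists (M + 1) => g.
  by apply: (fM (M + 1)) => //; rewrite ltrDl.
exists M; split; first exact: num_real.
by move=> N MN g _ /=; apply: le_trans (fM g) (ltW MN).
Qed.

Lemma linfty_submod_closed : submod_closed linfty_pred.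
Proof.
split=> [|a f h /linfty_predP[M fM] /linfty_predP[N hN]]; apply/linfty_predP.
  by exists 0 => g; rewrite normr0.
exists (`|a| * M + N) => g; apply: le_trans (ler_normD _ _) _.
by apply: lerD => //; rewrite normrM ler_wpM2l.
Qed.

HB.instance Definition _ :=
  GRing.isSubmodClosed.Build R (Gamma -> R) linfty_pred linfty_submod_closed.

Record linfty := Linfty {
  linfty_fun :> Gamma -> R ;
  linfty_funP : linfty_fun \in linfty_pred
}.

HB.instance Definition _ := [isSub for linfty_fun].
HB.instance Definition _ := [Choice of linfty by <:].
HB.instance Definition _ := [SubChoice_isSubLmodule of linfty by <:].

(* As sup set0 = 0, this is also the norm of the zero space when Gamma is empty. *)
Definition sup_norm (x : linfty) : R := sup (range (fun g => `|x g|)).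

Lemma sup_norm_ub (x : linfty) g : `|x g| <= sup_norm x.
Proof.
have /linfty_predP[M xM] := linfty_funP x.
apply: ub_le_sup; last by exists g.
by exists M => _ [h _ <-].
Qed.

Lemma sup_norm_le (x : linfty) r :
  0 <= r -> (forall g, `|x g| <= r) -> sup_norm x <= r.
Proof.
rewrite /sup_norm => r0 xr.
have [->|/set0P A0] := eqVneq (range (fun g => `|x g|)) set0.
  by rewrite sup0.
by apply: ge_sup => // _ [g _ <-].
Qed.

Lemma sup_norm_ge0 (x : linfty) : 0 <= sup_norm x.
Proof.
have [x0|/set0P[_ [g _ _]]] := eqVneq (range (fun g => `|x g|)) set0.
  by rewrite /sup_norm x0 sup0.
exact: le_trans (normr_ge0 _) (sup_norm_ub x g).
Qed.

Lemma sup_normD (x y : linfty) : sup_norm (x + y) <= sup_norm x + sup_norm y.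
Proof.
apply: sup_norm_le => [|g]; first by rewrite addr_ge0 ?sup_norm_ge0.
by apply: le_trans (ler_normD _ _) _; rewrite lerD ?sup_norm_ub.
Qed.

Lemma sup_norm0_eq0 (x : linfty) : sup_norm x = 0 -> x = 0.
Proof.
move=> x0; apply/val_inj/funext => g /=; apply/eqP.
by rewrite -normr_le0 -x0 sup_norm_ub.
Qed.

Lemma sup_normZ (a : R) (x : linfty) : sup_norm (a *: x) = `|a| * sup_norm x.
Proof.
have leZ b y : sup_norm (b *: y) <= `|b| * sup_norm y.
  apply: sup_norm_le => [|g]; first by rewrite mulr_ge0 ?sup_norm_ge0.
  by rewrite normrM ler_wpM2l ?sup_norm_ub.
apply/eqP; rewrite eq_le leZ /=.
have [->|a0] := eqVneq a 0; first by rewrite normr0 mul0r sup_norm_ge0.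
rewrite -ler_pdivlMl ?normr_gt0// -normfV.
by apply: le_trans (leZ _ _); rewrite scalerA mulVf// scale1r.
Qed.

HB.instance Definition _ :=
  Lmodule_isNormed.Build R linfty sup_normD sup_normZ sup_norm0_eq0.

Lemma linfty_normE (x : linfty) : `|x| = sup (range (fun g => `|x g|)).
Proof. by []. Qed.

Lemma linfty_complete (F : set_system linfty) :
  ProperFilter F -> cauchy F -> cvg F.
Proof.
move=> FF /cauchy_ballP Fc.
have Fev (e : R) : 0 < e ->
    exists2 A, F A & forall x y g, A x -> A y -> `|x g - y g| <= e.
  move=> e0; have [[A B] /= [FA FB] AB] := Fc _ e0.
  exists (A `&` B) => [|x y g [Ax _] [_ By]]; first exact: filterI.
  have /ltW := AB (x, y) (conj Ax By); apply: le_trans.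
  exact: (sup_norm_ub (x - y) g).
have Fg g : cvg ((fun x : linfty => x g : R^o) @ F).
  apply: cauchy_cvg; apply/cauchy_ballP => e e0.
  have [A FA Ae] := Fev _ (divr_gt0 e0 (ltr0Sn R 1)).
  exists ((fun x : linfty => x g) @` A, (fun x : linfty => x g) @` A) => /=.
    by split; apply: (@filterS _ F _ A) FA => x Ax; exists x.
  move=> [_ _] /= [[x Ax <-] [y Ay <-]].
  rewrite /ball /=; apply: le_lt_trans (Ae _ _ g Ax Ay) _.
  by rewrite ltr_pdivrMr// ltr_pMr// ltr1n.
pose l g : R := lim ((fun x : linfty => x g : R^o) @ F).
have le_l e A : F A -> (forall x y g, A x -> A y -> `|x g - y g| <= e) ->
    forall x g, A x -> `|l g - x g| <= e.
  move=> FA Ae x g Ax.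
  have lx : (fun y : linfty => `|(y g : R^o) - x g|) @ F --> `|l g - x g|.
    by apply: cvg_norm; apply: cvgB; [exact: Fg|exact: cvg_cst].
  apply: (closed_cvg (fun r : R => r <= e) _ _ _ lx); first exact: closed_le.
  by apply: (@filterS _ F _ A) FA => y Ay; exact: Ae.
have lb : l \in linfty_pred.
  have [A FA A1] := Fev _ ltr01.
  have [x Ax] := filter_ex FA.
  have /linfty_predP[M xM] := linfty_funP x.
  apply/linfty_predP; exists (1 + M) => g.
  rewrite -(subrK (x g) (l g)); apply: le_trans (ler_normD _ _) _.
  by rewrite lerD ?xM//; exact: (le_l _ _ FA A1).
apply/cvg_ex; exists (Linfty lb).
apply/cvgrPdist_le => e e0; have [A FA Ae] := Fev _ e0.
apply: filterS (FA) => x Ax.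
apply: sup_norm_le => [|g]; first exact: ltW.
exact: (le_l _ _ FA Ae x g Ax).
Qed.

HB.instance Definition _ := Uniform_isComplete.Build linfty linfty_complete.

Lemma linfty_unit_ballE : closed_ball (0 : linfty) 1 = [set x | `|x| <= 1].
Proof.
rewrite closed_ballE//; apply/seteqP.
by split=> x; rewrite /closed_ball_ /= sub0r normrN.
Qed.

End Linfty.

Definition extreme_points (R : numDomainType) (V : lmodType R) (A : set V) :
    set V :=
  [set x | A x /\ forall (y z : V) (t : R), A y -> A z -> 0 < t < 1 ->
             x = t *: y + (1 - t) *: z -> y = x /\ z = x].

(* Main.v *)
(* The extreme points of B are the functions with values in {1, -1}. As B has
   radius 1, F 0 = 0, so the image y of a nonzero multiple t d_g of a unit
   vector has some coordinate y_h <> 0. If e = F u is extreme and e_h y_h < 0,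
   then 1 < |y_h - e_h| <= |t d_g - u|, which forces 1 < |t - u_g|. Applying
   this to t and -t for all 0 < t <= 1 shows that u_g = s(g) e_phi(g) for some
   sign s(g) and some phi : Gamma -> Gamma independent of e. Then phi is onto
   because e determines u and conversely, and one-to-one because F maps the
   segment from 0 to s(g) d_g into the half-axis of d_phi(g), continuously and
   injectively. So every extreme point x arises as such a u, i.e. F x is
   extreme. *)
Require Import Defs.
From mathcomp Require Import all_boot all_order all_algebra.
From mathcomp Require Import all_classical all_reals all_analysis.
From mathcomp Require Import lra.
Import Order.TTheory GRing.Theory Num.Theory.
Import numFieldNormedType.Exports.
Local Open Scope classical_set_scope.
Local Open Scope ring_scope.

Set Implicit Arguments.
Unset Strict Implicit.
Unset Printing Implicit Defensive.

(** * Preliminaries on real numbers and real functions *)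

Lemma normr1_cases (R : realDomainType) (a : R) : `|a| = 1 -> a = 1 \/ a = -1.
Proof. by case: ler0P => _; lra. Qed.

Lemma nonexpansive_within_continuous (R : realType) (A : set R) (f : R -> R) :
  (forall s t, A s -> A t -> `|f s - f t| <= `|s - t|) ->
  {within A, continuous f}.
Proof.
move=> flip; apply/subspace_continuousP => s As.
apply/cvgrPdist_le => e e0; rewrite near_withinE.
near=> t => At; apply: le_trans (flip _ _ As At) _.
by near: t; apply: cvgr_dist_le; first exact: cvg_id.
Unshelve. all: by end_near. Qed.

Lemma nonexpansive_IVT (R : realType) (f : R -> R) (v : R) :
  (forall s t, 0 <= s <= 1 -> 0 <= t <= 1 -> `|f s - f t| <= `|s - t|) ->
  f 0 = 0 -> 0 < v <= f 1 -> exists2 t, 0 < t <= 1 & f t = v.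
Proof.
move=> flip f0 /andP[v0 v1].
have [| |t] := @IVT R f 0 1 v ler01.
- apply: nonexpansive_within_continuous => s t.
  by rewrite /= !in_itv /=; exact: flip.
- have f1 := ltW (lt_le_trans v0 v1).
  by rewrite f0 (min_l f1) (max_r f1) (ltW v0).
rewrite in_itv /= => /andP[t0 t1] ftv; exists t => //.
rewrite t1 lt_neqAle t0 !andbT; apply: contraTN v0 => /eqP t0'.
by rewrite -ftv -t0' f0 ltxx.
Qed.

(** * Multiples of unit vectors; the extreme points of the ball *)

Section Linfty.
Variables (R : realType) (Gamma : Type).
Implicit Types (x y z u : linfty Gamma R) (g h : Gamma).

Lemma linfty_ext x y : (forall g, x g = y g) -> x = y.
Proof. by move=> xy; apply/val_inj/funext. Qed.

Lemma linfty_norm_ub x g : `|x g| <= `|x|.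
Proof. exact: sup_norm_ub. Qed.

Lemma linfty_norm_le x (r : R) : 0 <= r -> (forall g, `|x g| <= r) -> `|x| <= r.
Proof. exact: sup_norm_le. Qed.

Lemma bounded_linfty (f : Gamma -> R) (M : R) :
  (forall g, `|f g| <= M) -> exists x, forall g, x g = f g.
Proof.
move=> fM; have lf : f \in @linfty_pred Gamma R by apply/linfty_predP; exists M.
by exists (Linfty lf).
Qed.

Lemma spike_subproof g (t : R) :
  (fun h => if `[< h = g >] then t else 0) \in @linfty_pred Gamma R.
Proof.
by apply/linfty_predP; exists `|t| => h; case: asboolP; rewrite ?normr0.
Qed.

(** The vector t d_g, with d_g the unit vector at [g]. *)
Definition spike g (t : R) := Linfty (spike_subproof g t).

Lemma spikeE g t : spike g t g = t.
Proof. by rewrite /=; case: asboolP. Qed.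

Lemma spike_neq g h t : h <> g -> spike g t h = 0.
Proof. by rewrite /=; case: asboolP. Qed.

Lemma norm_spike_le g t : `|spike g t| <= `|t|.
Proof. by apply: linfty_norm_le => // h /=; case: asboolP; rewrite ?normr0. Qed.

Lemma spikeB g s t : spike g s - spike g t = spike g (s - t).
Proof.
apply: linfty_ext => h; rewrite [LHS]/= /GRing.add /= /GRing.opp /=.
by case: asboolP; rewrite ?subr0.
Qed.

Definition unimodular x := forall g, `|x g| = 1.

Lemma unimodular_norm x : unimodular x -> `|x| <= 1.
Proof. by move=> ux; apply: linfty_norm_le => // g; rewrite ux. Qed.

Lemma unimodular_exists (f : Gamma -> R) :
  (forall g, `|f g| = 1) -> exists2 x, unimodular x & forall g, x g = f g.
Proof.
move=> f1; have [|x xf] := @bounded_linfty f 1; first by move=> g; rewrite f1.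
by exists x => // g; rewrite xf.
Qed.

Lemma extreme_points_unimodular x :
  extreme_points (closed_ball (0 : linfty Gamma R) 1) x <-> unimodular x.
Proof.
rewrite linfty_unit_ballE; split=> [[x1 xext] g|ux].
- apply/eqP; rewrite eq_le (le_trans (linfty_norm_ub x g) x1) /= leNgt.
  (* The slack [d] lets coordinate [g] move both ways inside the ball, so [x] is a proper
     midpoint. *)
  apply/negP => xg1; pose d := 1 - `|x g|.
  have d0 : 0 < d by rewrite subr_gt0.
  have xdB s : `|s| <= d -> `|x + spike g s| <= 1.
    move=> sd; apply: linfty_norm_le => // h.
    have [->|hg] := pselect (h = g).
      have -> : (x + spike g s) g = x g + s by rewrite -[in RHS](spikeE g s).
      by apply: le_trans (ler_normD _ _) _; rewrite /d in sd; lra.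
    have -> : (x + spike g s) h = x h + 0 by rewrite -(spike_neq s hg).
    by rewrite addr0; exact: le_trans (linfty_norm_ub x h) x1.
  have [| | | |xdx _] := xext (x + spike g d) (x + spike g (- d)) (1 / 2).
  + by apply: xdB; rewrite gtr0_norm.
  + by apply: xdB; rewrite normrN gtr0_norm.
  + by lra.
  + apply: linfty_ext => h.
    have -> : ((1 / 2) *: (x + spike g d) +
               (1 - 1 / 2) *: (x + spike g (- d))) h =
      (1 / 2) * (x h + spike g d h) + (1 - 1 / 2) * (x h + spike g (- d) h)
      by [].
    have [->|hg] := pselect (h = g); last by rewrite !spike_neq//; lra.
    by rewrite !spikeE; lra.
  have : (x + spike g d) g = x g + d by rewrite -[in RHS](spikeE g d).
  by rewrite xdx => xd; lra.
- split=> [|y z t y1 z1 /andP[t0 t1] xyz]; first exact: unimodular_norm.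
  have yz g : y g = x g /\ z g = x g.
    have /ler_normlP[yl yr] := le_trans (linfty_norm_ub y g) y1.
    have /ler_normlP[zl zr] := le_trans (linfty_norm_ub z g) z1.
    have xg : x g = t * y g + (1 - t) * z g by rewrite {1}xyz.
    (* A convex combination in [-1, 1] with positive weights reaches an endpoint only if both terms
       do. *)
    have [xg1|xg1] := normr1_cases (ux g).
    + by split; nra.
    + by split; nra.
  by split; apply: linfty_ext => g; have [] := yz g.
Qed.

End Linfty.

(** * Preimages of extreme points under a non-expansive bijection *)

Section NonexpansiveBijection.
Variables (R : realType) (Gamma : Type).
Variable F : linfty Gamma R -> linfty Gamma R.
Hypothesis F_inj : forall x y, `|x| <= 1 -> `|y| <= 1 -> F x = F y -> x = y.
Hypothesis F_surj : forall y, `|y| <= 1 -> exists2 x, `|x| <= 1 & F x = y.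
Hypothesis F_lip :
  forall x y, `|x| <= 1 -> `|y| <= 1 -> `|F x - F y| <= `|x - y|.
Implicit Types (x y z u : linfty Gamma R) (g h : Gamma).

(** Otherwise the preimage of the unit vector opposite to [F 0] is within 1 of [0], while the images
    are [|F 0| + 1] apart. *)
Lemma nonexpansive_bij0 : F 0 = 0.
Proof.
apply/eqP/negPn/negP => y0; set y := F 0 in y0.
have ny : 0 < `|y| by rewrite normr_gt0.
have [|u u1 Fu] := @F_surj (- `|y|^-1 *: y).
  by rewrite normrZ normrN normfV normr_id mulVf ?gt_eqF.
have : `|y - F u| <= 1.
  by apply: le_trans (F_lip _ u1) _; rewrite ?normr0// sub0r normrN.
rewrite Fu scaleNr opprK -[X in X + _]scale1r -scalerDl normrZ.
rewrite gtr0_norm ?addr_gt0 ?invr_gt0// mulrDl mulVf ?gt_eqF//; lra.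
Qed.

Lemma spike_image_neq0 g t : 0 < `|t| <= 1 -> exists h, F (spike g t) h != 0.
Proof.
move=> /andP[t0 t1]; apply: contrapT => /forallNP Ft0.
have s1 : `|spike g t| <= 1 := le_trans (norm_spike_le g t) t1.
have /(congr1 (fun x : linfty Gamma R => x g)) : spike g t = 0.
  apply: F_inj; rewrite ?normr0 // nonexpansive_bij0.
  apply: linfty_ext => h; apply/eqP; apply: contrapT => Fh; apply: (Ft0 h).
  exact/negP.
by rewrite spikeE => tz; move: t0; rewrite tz normr0 ltxx.
Qed.

Lemma spike_far g t u h : `|t| <= 1 -> `|u| <= 1 -> unimodular (F u) ->
  F u h * F (spike g t) h < 0 -> 1 < `|t - u g|.
Proof.
move=> t1 u1 uFu opp; rewrite ltNge; apply/negP => tu.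
have s1 : `|spike g t| <= 1 := le_trans (norm_spike_le g t) t1.
(* Off [g] the difference is [- u k], bounded by 1 in any case, so only coordinate [g] matters. *)
have : `|spike g t - u| <= 1.
  apply: linfty_norm_le => // k.
  have -> : (spike g t - u) k = spike g t k - u k by [].
  have [->|kg] := pselect (k = g); first by rewrite spikeE.
  by rewrite spike_neq// sub0r normrN; exact: le_trans (linfty_norm_ub _ _) u1.
move=> /(le_trans (F_lip s1 u1)) /(le_trans (linfty_norm_ub _ h)).
have -> : (F (spike g t) - F u) h = F (spike g t) h - F u h by [].
move=> /ler_normlP[]; case: (normr1_cases (uFu h)) opp => ->; nra.
Qed.

(** The spikes of heights [t] and [- t] turn out to have images with opposite signs at a common
    coordinate [h]. Whatever the sign of [F u h], it is opposite to one of the two, which pushes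
    [u g] beyond [1 - t] on a definite side. *)
Lemma preimage_coordinate_bound g t : 0 < t <= 1 ->
  exists hs : Gamma * R, `|hs.2| = 1 /\
    forall u, `|u| <= 1 -> unimodular (F u) -> 1 - t < hs.2 * F u hs.1 * u g.
Proof.
move=> /andP[t0 t1].
have nt : `|t| = t by rewrite gtr0_norm.
have [|h yh] := @spike_image_neq0 g t; first by rewrite nt t0.
have [|h' yh'] := @spike_image_neq0 g (- t); first by rewrite normrN nt t0.
(* As [|u g| <= 1] and [t > 0], the gap [|t - u g| > 1] can only open downwards. *)
have lo u : `|u| <= 1 -> unimodular (F u) ->
    F u h * F (spike g t) h < 0 -> u g < t - 1.
  move=> u1 uFu /spike_far; rewrite nt => /(_ t1 u1 uFu).
  have /ler_normlP[] := le_trans (linfty_norm_ub u g) u1.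
  by case: (ler0P (t - u g)) => _; lra.
have hi u : `|u| <= 1 -> unimodular (F u) ->
    F u h' * F (spike g (- t)) h' < 0 -> 1 - t < u g.
  move=> u1 uFu /spike_far; rewrite normrN nt => /(_ t1 u1 uFu).
  have /ler_normlP[] := le_trans (linfty_norm_ub u g) u1.
  by case: (ler0P (- t - u g)) => _; lra.
move: lo hi yh yh'.
set y := F (spike g t); set y' := F (spike g (- t)) => lo hi yh yh'.
have sgM (a : R) : a != 0 -> - Num.sg a * a < 0.
  by move=> a0; rewrite mulNr -normrEsg oppr_lt0 normr_gt0.
(* If [h' <> h], this [e] opposes [y] at [h] and [y'] at [h'], so its preimage would satisfy both
   [u g < t - 1] and [1 - t < u g], impossible for [t <= 1]. *)
have [|e ue eE] := @unimodular_exists R Gamma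
    (fun k => if `[< k = h >] then - Num.sg (y h) else - Num.sg (y' h')).
  by move=> k; case: asboolP => _; rewrite normrN normr_sg ?yh ?yh'.
have eh : e h * y h < 0 by rewrite eE; case: asboolP => // _; exact: sgM.
have [u u1 Fu] := F_surj (unimodular_norm ue); rewrite -Fu in ue eh.
have eh' : ~ F u h' * y' h' < 0.
  by move=> /(hi _ u1 ue); have := lo _ u1 ue eh; lra.
have hh : h' = h.
  apply: contrapT => hh; apply: eh'; rewrite Fu eE.
  by case: asboolP => // _; exact: sgM.
rewrite {}hh in eh' hi yh'.
exists (h, Num.sg (y h)) => /=; split; first by rewrite normr_sg yh.
move=> v v1 uFv.
have yy' : y h * y' h < 0.
  rewrite Fu eE in eh'; move: eh'; case: asboolP => // _ /negP.
  by case: sgrP yh yh' => //; case: (ltgtP (y' h) 0) => //; nra.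
have := lo _ v1 uFv; have := hi _ v1 uFv.
case: (normr1_cases (uFv h)) => -> ; case: sgrP yh yy' => // yh0 _ yy' H1 H2.
- by have := H1 ltac:(nra); lra.
- by have := H2 ltac:(nra); lra.
- by have := H2 ltac:(nra); lra.
- by have := H1 ltac:(nra); lra.
Qed.

(** The bound at height 1 fixes [h] and the sign of [u g] for all [u] at once. The modulus is 1,
    since height [1 - |u g|] would give [|u g| < |u g|]; the pair used there may depend on [u]. *)
Lemma preimage_coordinate g :
  exists hs : Gamma * R, `|hs.2| = 1 /\
    forall u, `|u| <= 1 -> unimodular (F u) -> u g = hs.2 * F u hs.1.
Proof.
have [|[h s] /= [s1 us]] := @preimage_coordinate_bound g 1.
  by rewrite ltr01 lexx.
exists (h, s); split => //= u u1 uFu.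
have ug : `|u g| = 1.
  apply/eqP; rewrite eq_le (le_trans (linfty_norm_ub u g) u1) /= leNgt.
  apply/negP => ug1.
  have [|[k r] /= [r1 ur]] := @preimage_coordinate_bound g (1 - `|u g|).
    by rewrite subr_gt0 ug1 lerBlDr lerDl normr_ge0.
  have := le_trans (ltW (ur _ u1 uFu)) (ler_norm _).
  have := lt_le_trans (ur _ u1 uFu) (ler_norm _).
  by rewrite !normrM r1 uFu !mul1r; lra.
have := us _ u1 uFu.
case: (normr1_cases ug) (normr1_cases s1) (normr1_cases (uFu h)).
all: by move=> -> [] -> [] ->; lra.
Qed.

(** * Bijectivity of the coordinate map *)

Section Coordinates.
Variables (phi : Gamma -> Gamma) (sigma : Gamma -> R).
Hypothesis sigma1 : forall g, `|sigma g| = 1.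
Hypothesis preimageE : forall g u, `|u| <= 1 -> unimodular (F u) ->
  u g = sigma g * F u (phi g).

(** If [h] were missed, flipping the sign of an extreme point at [h] would not change its
    preimage. *)
Lemma coordinate_map_surj h : exists g, phi g = h.
Proof.
apply: contrapT => /forallNP nphi.
have [|e ue eE] := @unimodular_exists R Gamma (fun=> 1).
  by move=> k; rewrite normr1.
have [|e' ue' eE'] := @unimodular_exists R Gamma
    (fun k => if `[< k = h >] then -1 else 1).
  by move=> k; case: asboolP; rewrite ?normrN normr1.
have [u u1 Fu] := F_surj (unimodular_norm ue).
have [u' u1' Fu'] := F_surj (unimodular_norm ue').
have uu' : u = u'.
  apply: linfty_ext => g.
  rewrite (preimageE g u1) ?Fu// (preimageE g u1') ?Fu'//.
  by rewrite eE eE'; case: asboolP => // /nphi.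
have : e h = e' h by rewrite -Fu -Fu' uu'.
by rewrite eE eE'; case: asboolP => // _; lra.
Qed.

Lemma spike_image g t : 0 < t <= 1 ->
  0 < F (spike g (sigma g * t)) (phi g) /\
  F (spike g (sigma g * t)) = spike (phi g) (F (spike g (sigma g * t)) (phi g)).
Proof.
move=> /andP[t0 t1]; set y := F _.
have nt : `|sigma g * t| = t by rewrite normrM sigma1 mul1r gtr0_norm.
(* Since [u g = sigma g * e (phi g)], [spike_far] reads [1 < |t - e (phi g)|], which rules out the
   value 1. *)
have lo e h : unimodular e -> e h * y h < 0 -> e (phi g) = -1.
  move=> ue; have [u u1 Fu] := F_surj (unimodular_norm ue).
  rewrite -Fu in ue *; move=> /spike_far; rewrite nt => /(_ t1 u1 ue).
  have /ler_normlP[] := le_trans (linfty_norm_ub u g) u1.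
  rewrite (preimageE g u1 ue).
  case: (normr1_cases (sigma1 g)) (normr1_cases (ue (phi g))) => -> [] -> //.
    by case: (ler0P (_ - _)) => _; lra.
  by case: (ler0P (_ - _)) => _; lra.
(* At another coordinate [h], [e] could oppose [y] there and still be 1 at [phi g], against [lo]. *)
have supp h : y h != 0 -> h = phi g.
  move=> yh; apply: contrapT => hg.
  have [|e ue eE] := @unimodular_exists R Gamma
      (fun k => if `[< k = h >] then - Num.sg (y h) else 1).
    by move=> k; case: asboolP => _; rewrite ?normrN ?normr_sg ?yh ?normr1.
  have := lo e h ue; rewrite !eE; case: asboolP => // _.
  rewrite mulNr -normrEsg oppr_lt0 normr_gt0 => /(_ yh).
  by case: asboolP => [/esym//|_]; lra.
have yphi : y (phi g) != 0.
  have [|h yh] := @spike_image_neq0 g (sigma g * t); first by rewrite nt t0.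
  by rewrite -(supp _ yh).
split; last first.
  apply: linfty_ext => h; have [->|hg] := pselect (h = phi g).
    by rewrite spikeE.
  rewrite spike_neq//; apply/eqP/negPn/negP => /supp; exact: hg.
have [|e ue eE] := @unimodular_exists R Gamma (fun=> 1).
  by move=> k; rewrite normr1.
rewrite lt_neqAle eq_sym yphi leNgt; apply/negP => yneg.
have := lo e (phi g) ue; rewrite !eE mul1r => /(_ yneg); lra.
Qed.

(* Two spikes sent to the same axis would, by the intermediate value theorem,
   have a common image. *)
Lemma coordinate_map_inj g h : phi g = phi h -> g = h.
Proof.
move=> gh.
pose c k t := F (spike k (sigma k * t)) (phi k).
have st1 k t : 0 <= t <= 1 -> `|spike k (sigma k * t)| <= 1.
  move=> /andP[t0 t1]; apply: le_trans (norm_spike_le _ _) _.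
  by rewrite normrM sigma1 mul1r ger0_norm.
have ivt k v : 0 < v <= c k 1 -> exists2 t, 0 < t <= 1 & c k t = v.
  apply: nonexpansive_IVT => [s t s01 t01|].
    have := F_lip (st1 k _ s01) (st1 k _ t01).
    move=> /(le_trans (linfty_norm_ub _ (phi k))) /le_trans; apply.
    rewrite spikeB; apply: le_trans (norm_spike_le _ _) _.
    by rewrite -mulrBr normrM sigma1 mul1r.
  rewrite /c mulr0 (_ : spike k 0 = 0) ?nonexpansive_bij0//.
  by apply: linfty_ext => l /=; case: asboolP.
have c1 k : 0 < c k 1 by have [] := @spike_image k 1; rewrite ?ltr01 ?lexx.
(* A positive value attained by both [c g] and [c h], which start at 0. *)
pose v := Num.min (c g 1) (c h 1).
have v0 : 0 < v by rewrite lt_min !c1.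
have [|s /andP[s0 s1] cs] := ivt g v; first by rewrite v0 ge_min lexx.
have [|t /andP[t0 t1] ct] := ivt h v; first by rewrite v0 ge_min lexx orbT.
have : spike g (sigma g * s) = spike h (sigma h * t).
  apply: F_inj; [by apply: st1; lra..|].
  have [|_ ->] := @spike_image g s; first by rewrite s0 s1.
  have [|_ ->] := @spike_image h t; first by rewrite t0 t1.
  by rewrite -/(c g s) -/(c h t) cs ct gh.
move=> /(congr1 (fun x : linfty Gamma R => `|x g|)); rewrite spikeE.
move=> gs; apply: contrapT => ngh; move: gs.
rewrite spike_neq// normr0 normrM sigma1 mul1r gtr0_norm// => s0'.
by rewrite s0' ltxx in s0.
Qed.

End Coordinates.

Lemma nonexpansive_bij_unimodular x : unimodular x -> unimodular (F x).
Proof.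
move=> ux.
have [hs hsP] := choice preimage_coordinate.
pose phi g := (hs g).1; pose sigma g := (hs g).2.
have sigma1 g : `|sigma g| = 1 by have [] := hsP g.
have preimageE g u : `|u| <= 1 -> unimodular (F u) ->
    u g = sigma g * F u (phi g) by have [_] := hsP g; exact.
have [psi psiK] := choice (coordinate_map_surj preimageE).
have phiK g : psi (phi g) = g.
  exact: (coordinate_map_inj sigma1 preimageE).
(* Chosen so that the preimage of [e] is [x]: its coordinate at [g] is [sigma g * sigma g * x g],
   and [sigma g] is a sign. *)
have [|e ue eE] := @unimodular_exists R Gamma
    (fun h => sigma (psi h) * x (psi h)).
  by move=> h; rewrite normrM sigma1 mul1r.
have [u u1 Fu] := F_surj (unimodular_norm ue).
suff -> : x = u by rewrite Fu.
rewrite -Fu in ue eE; apply: linfty_ext => g.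
rewrite (preimageE g u u1 ue) eE phiK mulrA.
by case: (normr1_cases (sigma1 g)) => ->; lra.
Qed.

End NonexpansiveBijection.

Theorem proposition4 (R : realType) (Gamma : Type)
    (F : linfty Gamma R -> linfty Gamma R) :
  let B := closed_ball (0 : linfty Gamma R) 1 in
  [set: Gamma] !=set0 ->
  set_bij B B F ->
  1.-lipschitz_B F ->
  F @` extreme_points B `<=` extreme_points B.
Proof.
move=> B _ [_ Finj Fsurj] Flip _ [x /extreme_points_unimodular ux <-].
apply/extreme_points_unimodular.
have BE y : B y <-> `|y| <= 1 by rewrite /B linfty_unit_ballE.
apply: (nonexpansive_bij_unimodular _ _ _ ux) => [y z|y|y z].
- by move=> /BE By /BE Bz; apply: Finj; rewrite inE.
- by move=> /BE /Fsurj[z /BE]; exists z.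
- move=> /BE By /BE Bz.
  by have := Flip (y, z) (conj By Bz); rewrite /= mul1r.
Qed.
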